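(* Let $\mathcal{I}=\left((\mathrm{E}_\alpha)_{\alpha\in I},(p_{\beta,\alpha})_{\beta\succcurlyeq\alpha}\right)$ be an inverse system in $\mathbf{NVL}$ and $\mathcal{S}=\left(\mathrm{E},(p_\alpha)_{\alpha\in I}\right)$ its inverse limit in $\mathbf{VL}$. The following statements are true. (i) If $\mathrm{E}_\alpha$ is $\sigma$-Dedekind complete for every $\alpha\in I$, then so is $\mathrm{E}$. (ii) If $\mathrm{E}_\alpha$ is Dedekind complete for every $\alpha\in I$, then so is $\mathrm{E}$. (iii) If $\mathrm{E}_\alpha$ is laterally complete for every $\alpha\in I$, then so is $\mathrm{E}$. (iv) If $\mathrm{E}_\alpha$ is universally complete for every $\alpha\in I$, then so is $\mathrm{E}$.
   Context: All vector lattices are real. $\mathbf{VL}$ and $\mathbf{NVL}$ are the categories of vector lattices with, respectively, (linear) lattice homomorphisms and normal (i.e. order continuous) lattice homomorphisms as morphisms. An inverse system in a category $\mathbf{C}$ consists of a directed set $I$, vector lattices $\mathrm{E}_\alpha$ and $\mathbf{C}$-morphisms $p_{\beta,\alpha}:\mathrm{E}_\beta\to\mathrm{E}_\alpha$ ($\beta\succcurlyeq\alpha$) with $p_{\beta,\alpha}\circ p_{\gamma,\beta}=p_{\gamma,\alpha}$ for $\alpha\preccurlyeq\beta\preccurlyeq\gamma$. Its inverse limit in $\mathbf{VL}$ is (up to unique isomorphism) $\mathrm{E}=\{(u_\alpha)\in\prod\mathrm{E}_\alpha : u_\alpha=p_{\beta,\alpha}(u_\beta) \text{ for all } \alpha\preccurlyeq\beta\}$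 with coordinatewise operations and $p_\alpha:\mathrm{E}\to\mathrm{E}_\alpha$ the restricted coordinate projections. A vector lattice is laterally complete if every set of pairwise disjoint positive elements has a supremum, and universally complete if it is Dedekind complete and laterally complete. *)

(* Defs.v *)
From HB Require Import structures.
From mathcomp Require Import all_boot all_order all_algebra.
From mathcomp Require Import boolp classical_sets functions cardinality reals.

Set Implicit Arguments.
Unset Strict Implicit.
Unset Printing Implicit Defensive.

Import Order.TTheory GRing.Theory Num.Theory.

Local Open Scope classical_set_scope.
Local Open Scope ring_scope.

(* The lattice operations are part of this mixin, with the axioms that
   Order.Lattice uses for them: Hierarchy-Builder rejects a new structure that
   inherits from both Order.Lattice and GRing.Zmodule, because Num.RealDomain
   already inherits from both and their join was not declared before it. *)
HB.mixin Record POrder_Lmodule_isVectorLattice (R : numDomainType) V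
    of GRing.Lmodule R V & Order.POrder ring_display V := {
  vl_leD2r : forall x y z : V, x <= y -> x + z <= y + z;
  vl_leZ2l : forall (a : R) (x y : V), 0 <= a -> x <= y -> a *: x <= a *: y;
  vjoin : V -> V -> V;
  vmeet : V -> V -> V;
  vl_leUx : forall x y z : V, (vjoin x y <= z) = (x <= z) && (y <= z);
  vl_lexI : forall x y z : V, (x <= vmeet y z) = (x <= y) && (x <= z)
}.

#[short(type="vectorLatticeType")]
HB.structure Definition VectorLattice (R : numDomainType) :=
  {V of GRing.Lmodule R V & Order.POrder ring_display V
      & POrder_Lmodule_isVectorLattice R V}.

Section vector_lattice.
Context {R : realType}.
Implicit Types E F : vectorLatticeType R.

Definition vabs E (x : E) : E := vjoin x (- x).

Definition disjoint_elts E (x y : E) := vmeet (vabs x) (vabs y) = 0.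

Definition sigma_dedekind_complete E := forall A : set E,
  A !=set0 -> countable A -> has_ubound A -> supremums A !=set0.

Definition dedekind_complete E := forall A : set E,
  A !=set0 -> has_ubound A -> supremums A !=set0.

(* A is required to be nonempty: the empty set has a supremum in E, i.e. E has
   a least element, only if E = {0}. *)
Definition laterally_complete E := forall A : set E,
  A !=set0 -> (forall x, A x -> 0 <= x) ->
  (forall x y, A x -> A y -> x <> y -> disjoint_elts x y) ->
  supremums A !=set0.

Definition universally_complete E :=
  dedekind_complete E /\ laterally_complete E.

Definition lattice_hom E F (T : E -> F) :=
  [/\ linear T,
      {morph T : x y / vjoin x y >-> vjoin x y} &
      {morph T : x y / vmeet x y >-> vmeet x y}].

Definition downward_directed E (D : set E) :=
  D !=set0 /\
  forall x y, D x -> D y -> exists z, [/\ D z, z <= x & z <= y].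

Definition order_continuous E F (T : E -> F) := forall D : set E,
  downward_directed D -> infimums D 0 ->
  infimums [set vabs (T u) | u in D] 0.

Definition normal_lattice_hom E F (T : E -> F) :=
  lattice_hom T /\ order_continuous T.

End vector_lattice.

Definition morphism_class (R : realType) :=
  forall E F : vectorLatticeType R, (E -> F) -> Prop.

Definition VL (R : realType) : morphism_class R := fun E F T => lattice_hom T.

Definition NVL (R : realType) : morphism_class R :=
  fun E F T => normal_lattice_hom T.

Arguments VL : clear implicits.
Arguments NVL : clear implicits.

Definition directed d (I : preorderType d) :=
  inhabited I /\ forall a b : I, exists c : I, (a <= c)%O /\ (b <= c)%O.

Section inverse_systems.
Context {R : realType} {d : Order.disp_t} {I : preorderType d}.
Variables (C : morphism_class R).
Variable (E_ : I -> vectorLatticeType R).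
Variable (p : forall b a : I, (a <= b)%O -> E_ b -> E_ a).

(* p_(a,a) is not required to be the identity; taking a = b = c only makes it
   idempotent. *)
Definition inverse_system :=
  [/\ directed I,
      forall b a (ab : (a <= b)%O), C (p ab) &
      forall a b c (ab : (a <= b)%O) (bc : (b <= c)%O) (ac : (a <= c)%O),
        p ab \o p bc = p ac].

Definition compatible_system (E : vectorLatticeType R)
    (q : forall a, E -> E_ a) :=
  (forall a, C (q a)) /\ forall b a (ab : (a <= b)%O), p ab \o q b = q a.

Definition inverse_limit (E : vectorLatticeType R) (q : forall a, E -> E_ a) :=
  compatible_system q /\
  forall (F : vectorLatticeType R) (r : forall a, F -> E_ a),
    compatible_system r ->
    exists! h : F -> E, C h /\ forall a, q a \o h = r a.

End inverse_systems.

Section concrete_limit.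
Context {R : realType} {d : Order.disp_t} {I : preorderType d}.
Variable (E_ : I -> vectorLatticeType R).
Variable (p : forall b a : I, (a <= b)%O -> E_ b -> E_ a).
Hypothesis sysp : inverse_system (VL R) p.

(* The parameter s is needed because the operations below preserve threads only
   when the bonding maps are lattice homomorphisms. *)
Record thread (s : inverse_system (VL R) p) := Thread {
  coord : forall a, E_ a;
  threadP : forall b a (ab : (a <= b)%O), coord a = p ab (coord b) }.

Local Notation lim := (thread sysp).
Implicit Types u v w : lim.

Lemma thread_eq u v : (forall a, coord u a = coord v a) -> u = v.
Proof.
case: u v => [u hu] [v hv] /= uv.
have {}uv : u = v by apply: functional_extensionality_dep.
by case: _ / uv hv => hv; congr Thread; exact: Prop_irrelevance.
Qed.

Let p_hom b a (ab : (a <= b)%O) : lattice_hom (p ab).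
Proof. by case: sysp => _ + _; exact. Qed.

Let p_lin b a (ab : (a <= b)%O) : linear (p ab).
Proof. by case: (p_hom ab). Qed.

Let pD b a (ab : (a <= b)%O) x y : p ab (x + y) = p ab x + p ab y.
Proof. by have := p_lin ab 1 x y; rewrite !scale1r. Qed.

Let p0 b a (ab : (a <= b)%O) : p ab 0 = 0.
Proof. by apply: (addIr (p ab 0)); rewrite -pD !add0r. Qed.

Let pZ b a (ab : (a <= b)%O) k x : p ab (k *: x) = k *: p ab x.
Proof. by have := p_lin ab k x 0; rewrite addr0 p0 addr0. Qed.

Let pN b a (ab : (a <= b)%O) x : p ab (- x) = - p ab x.
Proof. by rewrite -scaleN1r pZ scaleN1r. Qed.

HB.instance Definition _ := gen_eqMixin lim.
HB.instance Definition _ := gen_choiceMixin lim.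

Let isthread (x : forall a, E_ a) :=
  forall b a (ab : (a <= b)%O), x a = p ab (x b).

Let thread0_subproof : isthread (fun=> 0).
Proof. by move=> b a ab; rewrite p0. Qed.
Let threadN_subproof u : isthread (fun a => - coord u a).
Proof. by move=> b a ab; rewrite pN -threadP. Qed.
Let threadD_subproof u v : isthread (fun a => coord u a + coord v a).
Proof. by move=> b a ab; rewrite pD -!threadP. Qed.
Let threadZ_subproof (k : R) u : isthread (fun a => k *: coord u a).
Proof. by move=> b a ab; rewrite pZ -threadP. Qed.
Let threadU_subproof u v : isthread (fun a => vjoin (coord u a) (coord v a)).
Proof. by move=> b a ab; case: (p_hom ab) => _ -> _; rewrite -!threadP. Qed.
Let threadI_subproof u v : isthread (fun a => vmeet (coord u a) (coord v a)).
Proof. by move=> b a ab; case: (p_hom ab) => _ _ ->; rewrite -!threadP. Qed.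

Definition thread0 : lim := Thread sysp thread0_subproof.
Definition threadN u : lim := Thread sysp (threadN_subproof u).
Definition threadD u v : lim := Thread sysp (threadD_subproof u v).
Definition threadZ (k : R) u : lim := Thread sysp (threadZ_subproof k u).
Definition threadU u v : lim := Thread sysp (threadU_subproof u v).
Definition threadI u v : lim := Thread sysp (threadI_subproof u v).

Let addA : associative threadD.
Proof. by move=> u v w; apply: thread_eq => a; exact: addrA. Qed.
Let addC : commutative threadD.
Proof. by move=> u v; apply: thread_eq => a; exact: addrC. Qed.
Let add0 : left_id thread0 threadD.
Proof. by move=> u; apply: thread_eq => a; exact: add0r. Qed.
Let addN : left_inverse thread0 threadN threadD.
Proof. by move=> u; apply: thread_eq => a; exact: addNr. Qed.

HB.instance Definition _ := GRing.isZmodule.Build lim addA addC add0 addN.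

Let scaleA k l u : threadZ k (threadZ l u) = threadZ (k * l) u.
Proof. by apply: thread_eq => a; exact: scalerA. Qed.
Let scale1 : left_id 1 threadZ.
Proof. by move=> u; apply: thread_eq => a; exact: scale1r. Qed.
Let scaleDr : right_distributive threadZ +%R.
Proof. by move=> k u v; apply: thread_eq => a; exact: scalerDr. Qed.
Let scaleDl u : {morph threadZ^~ u : k l / k + l}.
Proof. by move=> k l; apply: thread_eq => a; exact: scalerDl. Qed.

HB.instance Definition _ :=
  GRing.Zmodule_isLmodule.Build R lim scaleA scale1 scaleDr scaleDl.

Definition thread_le u v := `[< forall a, coord u a <= coord v a >].

Let le_refl : reflexive thread_le.
Proof. by move=> u; apply/asboolP. Qed.
Let le_anti : antisymmetric thread_le.
Proof.
move=> u v /andP[/asboolP uv /asboolP vu]; apply: thread_eq => a.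
by apply: le_anti; rewrite uv vu.
Qed.
Let le_trans : transitive thread_le.
Proof.
move=> v u w /asboolP uv /asboolP vw; apply/asboolP => a.
exact: le_trans (uv a) (vw a).
Qed.

HB.instance Definition _ :=
  Order.Le_isPOrder.Build ring_display lim le_refl le_anti le_trans.

Let leP u v : reflect (forall a, coord u a <= coord v a) (u <= v).
Proof. exact: asboolP. Qed.

Let leD2r u v w : u <= v -> u + w <= v + w.
Proof. by move=> /leP uv; apply/leP => a; exact: (vl_leD2r _ _ _ (uv a)). Qed.
Let leZ2l (k : R) u v : 0 <= k -> u <= v -> k *: u <= k *: v.
Proof. by move=> k0 /leP uv; apply/leP => a; exact: (vl_leZ2l _ _ _ k0 (uv a)). Qed.
Let leUx u v w : (threadU u v <= w) = (u <= w) && (v <= w).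
Proof.
apply/leP/andP => [uvw|[/leP uw /leP vw] a]; last by rewrite vl_leUx uw vw.
by split; apply/leP => a; have := uvw a; rewrite vl_leUx => /andP[].
Qed.
Let lexI u v w : (u <= threadI v w) = (u <= v) && (u <= w).
Proof.
apply/leP/andP => [uvw|[/leP uv /leP uw] a]; last by rewrite vl_lexI uv uw.
by split; apply/leP => a; have := uvw a; rewrite vl_lexI => /andP[].
Qed.

HB.instance Definition _ :=
  POrder_Lmodule_isVectorLattice.Build R lim leD2r leZ2l leUx lexI.

Lemma thread_inverse_limit :
  inverse_limit (VL R) p (fun a (u : lim) => coord u a).
Proof.
split.
  split=> [a|b a ab]; first by split.
  by apply/funext => u /=; rewrite -threadP.
move=> F r [rhom rp].
have rt y b a (ab : (a <= b)%O) : r a y = p ab (r b y) by rewrite -(rp _ _ ab).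
pose h y : lim := Thread sysp (rt y).
exists h; split=> [|g [_ gr]].
  split; last by move=> a.
  by split=> [k x y|x y|x y]; apply: thread_eq => a; case: (rhom a) => rl rU rI;
    [exact: rl|exact: rU|exact: rI].
by apply/funext => y; apply: thread_eq => a; rewrite /= -(gr a).
Qed.

End concrete_limit.

(* Main.v *)
(** Order continuity makes the bonding maps preserve existing suprema of
    nonempty sets.  Hence, for a nonempty set [A] in the limit, the suprema of
    the projections of [A] form a thread, and this thread is the supremum of
    [A].  Each completeness hypothesis on the [E_ a] provides these
    coordinatewise suprema, because projections preserve countability,
    boundedness, positivity and disjointness. *)
Require Import Defs.
From mathcomp Require Import all_boot all_order all_algebra.
From mathcomp Require Import boolp classical_sets functions cardinality reals.

Set Implicit Arguments.
Unset Strict Implicit.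
Unset Printing Implicit Defensive.

Import Order.TTheory GRing.Theory Num.Theory.

Local Open Scope classical_set_scope.
Local Open Scope ring_scope.

Section vector_lattice_theory.
Context {R : realType}.
Implicit Types E F : vectorLatticeType R.

Lemma vmeet_idPl E (x y : E) : x <= y -> vmeet x y = x.
Proof.
move=> xy; apply: le_anti; rewrite vl_lexI lexx xy !andbT.
by have := lexx (vmeet x y); rewrite vl_lexI => /andP[].
Qed.

Lemma vl_lerBC E (x y z : E) : x <= y - z -> z <= y - x.
Proof.
by move/(@vl_leD2r _ _ _ _ (z - x)); rewrite addrCA subrr addr0 addrA subrK.
Qed.

Lemma vl_lerB2l E (x y z : E) : x <= y -> z - y <= z - x.
Proof. by move=> xy; apply: vl_lerBC; rewrite opprB addrC subrK. Qed.

Section lattice_hom_theory.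
Context {E F : vectorLatticeType R} {T : E -> F} (homT : lattice_hom T).

Lemma lattice_hom_linear : linear T. Proof. by case: homT. Qed.

Lemma lattice_homD : {morph T : x y / x + y}.
Proof. by move=> x y; have := lattice_hom_linear 1 x y; rewrite !scale1r. Qed.

Lemma lattice_hom0 : T 0 = 0.
Proof. by apply: (addIr (T 0)); rewrite -lattice_homD !add0r. Qed.

Lemma lattice_homN : {morph T : x / - x}.
Proof.
by move=> x; apply: (addIr (T x)); rewrite -lattice_homD !addNr lattice_hom0.
Qed.

Lemma lattice_homB : {morph T : x y / x - y}.
Proof. by move=> x y; rewrite lattice_homD lattice_homN. Qed.

Lemma lattice_homU : {morph T : x y / vjoin x y}. Proof. by case: homT. Qed.

Lemma lattice_homI : {morph T : x y / vmeet x y}. Proof. by case: homT. Qed.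

Lemma lattice_hom_abs : {morph T : x / vabs x}.
Proof. by move=> x; rewrite /vabs lattice_homU lattice_homN. Qed.

Lemma lattice_hom_le : {homo T : x y / x <= y}.
Proof.
move=> x y /vmeet_idPl xy; have := lexx (T x).
by rewrite -{2}xy lattice_homI vl_lexI => /andP[].
Qed.

Lemma lattice_hom_disjoint x y :
  disjoint_elts x y -> disjoint_elts (T x) (T y).
Proof.
by rewrite /disjoint_elts -!lattice_hom_abs -lattice_homI => ->; exact: lattice_hom0.
Qed.

End lattice_hom_theory.

(* [order_continuous] only concerns directed sets; closing [A] under joins makes
   it directed without changing its upper bounds. *)
Inductive join_closure E (A : set E) : set E :=
| join_closure_in x of A x : join_closure A x
| join_closureU x y of join_closure A x & join_closure A y :
    join_closure A (vjoin x y).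

(** [T] turns joins of elements into joins of their images, so an upper bound of the images survives
    each step of the closure. The case [T = id] gives the bounds of the closure itself. *)
Lemma lattice_hom_ubound_join_closure E F (T : E -> F) (A : set E) y :
  lattice_hom T -> ubound (T @` A) y -> ubound (T @` join_closure A) y.
Proof.
move=> homT Ay _ [j Aj <-]; elim: Aj => [x Ax|u v _ IHu _ IHv].
  by apply: Ay; exists x.
by rewrite (lattice_homU homT) vl_leUx IHu.
Qed.

Lemma ubound_join_closure E (A : set E) y :
  ubound A y -> ubound (join_closure A) y.
Proof.
have hom_id : lattice_hom (@id E) by split.
by have := @lattice_hom_ubound_join_closure _ _ _ A y hom_id; rewrite !image_id.
Qed.

(** The differences [s - j], for [j] in the join closure of [A], form a downward directed set with
    infimum 0, and it is to this set that order continuity applies. *)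
Lemma normal_lattice_hom_supremums E F (T : E -> F) (A : set E) s :
  normal_lattice_hom T -> A !=set0 -> supremums A s ->
  supremums (T @` A) (T s).
Proof.
move=> [homT ocT] [a Aa] [sA smin]; split.
  by move=> _ [x Ax <-]; apply: (lattice_hom_le homT); exact: sA.
pose D := [set s - j | j in join_closure A].
have dirD : downward_directed D.
  split; first by exists (s - a), a => //; exact: join_closure_in.
  move=> _ _ [j Aj <-] [k Ak <-]; exists (s - vjoin j k).
  have := lexx (vjoin j k); rewrite vl_leUx => /andP[jk kj].
  split; first by exists (vjoin j k) => //; exact: join_closureU.
    exact: vl_lerB2l.
  exact: vl_lerB2l.
have infD : infimums D 0.
  split.
    move=> _ [j Aj <-]; apply: vl_lerBC; rewrite subr0.
    exact: ubound_join_closure sA _ Aj.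
  (* A lower bound [z] of [D] makes [s - z] an upper bound of [A], so minimality of [s] forces
     [z <= 0]. *)
  move=> z Dz; have : s <= s - z.
    apply: smin => x Ax; apply: vl_lerBC; apply: Dz.
    by exists x => //; exact: join_closure_in.
  by move=> /vl_lerBC; rewrite subrr.
have [_ inf0] := ocT D dirD infD.
(* [T s - y] is a lower bound of the elements [vabs (T (s - j))], whose infimum is 0: indeed
   [T s - y <= T s - T j <= vabs (T (s - j))]. *)
move=> y Ay; suff : T s - y <= 0.
  by move=> /(@vl_leD2r _ _ _ _ y); rewrite subrK add0r.
apply: inf0 => _ [_ [j Aj <-] <-].
apply: (@le_trans _ _ (T (s - j))); last first.
  by have := lexx (vabs (T (s - j))); rewrite vl_leUx => /andP[].
rewrite (lattice_homB homT); apply: vl_lerB2l.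
by apply: (lattice_hom_ubound_join_closure homT Ay); exists j.
Qed.

End vector_lattice_theory.

Section inverse_limit_theory.
Context {R : realType} {d : Order.disp_t} {I : preorderType d}.
Context {E_ : I -> vectorLatticeType R}.
Context {p : forall b a : I, (a <= b)%O -> E_ b -> E_ a}.
Context {E : vectorLatticeType R} {q : forall a : I, E -> E_ a}.

Lemma inverse_system_NVL_VL :
  inverse_system (NVL R) p -> inverse_system (VL R) p.
Proof. by case=> dirI homp pp; split=> // b a ab; case: (homp b a ab). Qed.

Hypothesis limE : inverse_limit (VL R) p q.

Lemma inverse_limit_hom a : lattice_hom (q a).
Proof. by case: limE => -[homq _] _; exact: homq. Qed.

(** The limit is known only through its universal property; comparing it with the concrete limit of
    threads gives access to its order and lets elements be built coordinate by coordinate. *)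
Lemma inverse_limit_thread_iso (sysp : inverse_system (VL R) p) :
  exists (h : thread sysp -> E) (k : E -> thread sysp),
    [/\ lattice_hom h, forall a u, q a (h u) = Defs.coord u a,
        forall a x, Defs.coord (k x) a = q a x & cancel k h].
Proof.
have [compq univq] := limE.
have [compc univc] := thread_inverse_limit sysp.
have [h [[homh qh] _]] := univq _ _ compc.
have [k [[homk ck] _]] := univc _ _ compq.
have qhE a u : q a (h u) = Defs.coord u a.
  by have := congr1 (@^~ u) (qh a).
have ckE a x : Defs.coord (k x) a = q a x.
  by have := congr1 (@^~ x) (ck a).
exists h, k; split=> // x.
(* Both [id] and [h \o k] are morphisms from the cone [q] to itself, so uniqueness identifies
   them. *)
have [g [_ guniq]] := univq _ _ compq.
have gid : g = id by apply: guniq; split; [split|].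
have ghk : g = h \o k.
  apply: guniq; split; last first.
    by move=> a; apply/funext => y /=; rewrite qhE ckE.
  split=> [r y z|y z|y z] /=.
  - by rewrite (lattice_hom_linear homk) (lattice_hom_linear homh).
  - by rewrite (lattice_homU homk) (lattice_homU homh).
  - by rewrite (lattice_homI homk) (lattice_homI homh).
by have : (h \o k) x = x by rewrite -ghk gid.
Qed.

Hypothesis sysp : inverse_system (NVL R) p.

(** Threads are ordered coordinatewise, and the monotone map [h] carries the inequality between
    [k x] and [k y] back to [E]. *)
Lemma inverse_limit_le x y : (forall a, q a x <= q a y) -> x <= y.
Proof.
move=> xy.
have [h [k [homh _ ck hk]]] :=
  inverse_limit_thread_iso (inverse_system_NVL_VL sysp).
rewrite -(hk x) -(hk y); apply: (lattice_hom_le homh).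
by apply/asboolP => a; rewrite !ck.
Qed.

Lemma inverse_limit_supremums (A : set E) : A !=set0 ->
  (forall a, supremums (q a @` A) !=set0) -> supremums A !=set0.
Proof.
move=> A0 supA; pose s a := projT1 (cid (supA a)).
have sP a : supremums (q a @` A) (s a) := projT2 (cid (supA a)).
have qp b a (ab : (a <= b)%O) : p ab \o q b = q a.
  by case: limE => -[_ qp] _; exact: qp.
have normp b a (ab : (a <= b)%O) : normal_lattice_hom (p ab).
  by case: sysp => _ + _; exact.
have s_thread b a (ab : (a <= b)%O) : s a = p ab (s b).
  (* Since [p ab] preserves suprema, [p ab (s b)] is also a supremum of the image of [A] under
     [q a]; uniqueness of suprema concludes. *)
  apply: is_subset1_supremums (sP a) _; rewrite -(qp _ _ ab) -image_comp.
  by apply: normal_lattice_hom_supremums => //; exact: image_nonempty.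
have [h [_ [_ qh _ _]]] :=
  inverse_limit_thread_iso (inverse_system_NVL_VL sysp).
pose u : thread (inverse_system_NVL_VL sysp) := Thread _ s_thread.
(* The coordinates of [h u] are the suprema [s a], so both the bound and its minimality are checked
   in each [E_ a]. *)
exists (h u); split=> [x Ax|y Ay]; apply: inverse_limit_le => a;
  rewrite qh /=; have [ubs mins] := sP a.
  by apply: ubs; exists x.
apply: mins => _ [x Ax <-]; apply: (lattice_hom_le (inverse_limit_hom a)).
exact: Ay.
Qed.

Lemma inverse_limit_has_ubound (A : set E) a :
  has_ubound A -> has_ubound (q a @` A).
Proof.
move=> [y Ay]; exists (q a y) => _ [x Ax <-].
by apply: (lattice_hom_le (inverse_limit_hom a)); exact: Ay.
Qed.

Lemma inverse_limit_sigma_dedekind_complete :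
  (forall a, sigma_dedekind_complete (E_ a)) -> sigma_dedekind_complete E.
Proof.
move=> cE A A0 cA ubA; apply: inverse_limit_supremums => // a.
apply: cE; [exact: image_nonempty| |exact: inverse_limit_has_ubound].
exact: sub_countable (card_image_le _ _) cA.
Qed.

Lemma inverse_limit_dedekind_complete :
  (forall a, dedekind_complete (E_ a)) -> dedekind_complete E.
Proof.
move=> cE A A0 ubA; apply: inverse_limit_supremums => // a.
by apply: cE; [exact: image_nonempty|exact: inverse_limit_has_ubound].
Qed.

Lemma inverse_limit_laterally_complete :
  (forall a, laterally_complete (E_ a)) -> laterally_complete E.
Proof.
move=> cE A A0 posA disjA; apply: inverse_limit_supremums => // a.
have homq := inverse_limit_hom a.
apply: cE; first exact: image_nonempty.
  move=> _ [x Ax <-]; rewrite -(lattice_hom0 homq).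
  by apply: (lattice_hom_le homq); exact: posA.
move=> _ _ [x Ax <-] [y Ay <-] qxy; apply: (lattice_hom_disjoint homq).
(* Distinct images come from distinct elements of [A], which are disjoint by assumption. *)
by apply: disjA => // xy; apply: qxy; rewrite xy.
Qed.

End inverse_limit_theory.

Theorem theorem4p8 (R : realType) (d : Order.disp_t) (I : preorderType d)
    (E_ : I -> vectorLatticeType R)
    (p : forall b a : I, (a <= b)%O -> E_ b -> E_ a)
    (E : vectorLatticeType R) (q : forall a : I, E -> E_ a) :
  inverse_system (NVL R) p -> inverse_limit (VL R) p q ->
  [/\ (forall a, sigma_dedekind_complete (E_ a)) -> sigma_dedekind_complete E,
      (forall a, dedekind_complete (E_ a)) -> dedekind_complete E,
      (forall a, laterally_complete (E_ a)) -> laterally_complete E &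
      (forall a, universally_complete (E_ a)) -> universally_complete E].
Proof.
move=> sysp limE; split.
- exact: inverse_limit_sigma_dedekind_complete limE sysp.
- exact: inverse_limit_dedekind_complete limE sysp.
- exact: inverse_limit_laterally_complete limE sysp.
- move=> cE; split.
    by apply: (inverse_limit_dedekind_complete limE sysp) => a; case: (cE a).
  by apply: (inverse_limit_laterally_complete limE sysp) => a; case: (cE a).
Qed.
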